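(* Let $k$ be a field, let $G$ be a finite simple graph with vertex set $V_G=\{x_1,\ldots,x_n\}$, and let $I(G)\subseteq R=k[x_1,\ldots,x_n]$ be its edge ideal. Then for all $i \geq 0$ $$\beta_{i,i+2}(I(G)) \geq \sum_{v \in V_G} \binom{\deg v}{i+1} - k_{i+2}(G) + \sum_{a=2}^{\lfloor (i+2)/2\rfloor} k_{a,\,i+2-a}(G),$$ that is, the last sum is $k_{2,i}(G)+k_{3,i-1}(G)+\cdots+k_{\lfloor \frac{i+2}{2}\rfloor,\lceil \frac{i+2}{2}\rceil}(G)$ (an empty sum, equal to $0$, when $i=0$ or $1$).
   Context: A simple graph has no loops or multiple edges; it need not be connected. The edge ideal of $G$, with edge set $E_G$, is $I(G)=\langle x_ix_j \mid \{x_i,x_j\}\in E_G\rangle\subseteq R=k[x_1,\ldots,x_n]$. For a homogeneous ideal $I\subseteq R$ (standard grading), the graded Betti numbers are $\beta_{i,j}(I)=\dim_k \operatorname{Tor}^R_i(I,k)_j$. The degree $\deg v$ of a vertex $v$ is the number of edges incident to $v$. The numbers $k_m(G)$ and $k_{a,b}(G)$ are the numbers of induced subgraphs of $G$ (i.e. of subsets $S\subseteq V_G$ whose induced subgraph $G_S$ is) isomorphic respectively to the complete graph $K_m$ and the complete bipartite graph $K_{a,b}$. *)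

(* Defs.v *)
From HB Require Import structures.
From mathcomp Require Import all_boot all_order all_algebra.
From mathcomp Require Import mpoly.

Set Implicit Arguments.
Unset Strict Implicit.
Unset Printing Implicit Defensive.

Import GRing.Theory.

Local Open Scope ring_scope.

Record simple_graph (V : finType) := SimpleGraph {
  edges : {set {set V}};
  edges_card2 : forall A : {set V}, A \in edges -> #|A| = 2%N }.

Definition adj (V : finType) (G : simple_graph V) (x y : V) : bool :=
  [set x; y] \in edges G.

Definition degree (V : finType) (G : simple_graph V) (v : V) : nat :=
  #|[set A in edges G | v \in A]|.

Lemma complete_graph_subproof (m : nat) (A : {set 'I_m}) :
  A \in [set B : {set 'I_m} | #|B| == 2%N] -> #|A| = 2%N.
Proof. by rewrite inE => /eqP. Qed.

Definition complete_graph (m : nat) : simple_graph 'I_m :=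
  SimpleGraph (@complete_graph_subproof m).

Definition bipartite_edges (a b : nat) : {set {set 'I_a + 'I_b}} :=
  [set [set (inl x : 'I_a + 'I_b); inr y] | x : 'I_a, y : 'I_b].

Lemma complete_bipartite_subproof (a b : nat) (A : {set 'I_a + 'I_b}) :
  A \in bipartite_edges a b -> #|A| = 2%N.
Proof. by case/imset2P => x y _ _ ->; rewrite cards2. Qed.

Definition complete_bipartite (a b : nat) : simple_graph ('I_a + 'I_b)%type :=
  SimpleGraph (@complete_bipartite_subproof a b).

(* The subgraph of G induced on S is isomorphic to H; the isomorphism is      *)
(* given as an injection of the vertices of H into those of G with image S.   *)
Definition induced_iso (V W : finType) (G : simple_graph V)
    (H : simple_graph W) (S : {set V}) : bool :=
  [exists g : {ffun W -> V},
    [&& injectiveb g, g @: [set: W] == S &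
        [forall x, forall y, adj G (g x) (g y) == adj H x y]]].

Definition num_induced (V W : finType) (G : simple_graph V)
    (H : simple_graph W) : nat :=
  #|[set S : {set V} | induced_iso G H S]|.

Definition num_complete (V : finType) (G : simple_graph V) (m : nat) : nat :=
  num_induced G (complete_graph m).

Definition num_bipartite (V : finType) (G : simple_graph V) (a b : nat) : nat :=
  num_induced G (complete_bipartite a b).

Definition ideal_gen (R : comNzRingType) (gens : R -> Prop) (p : R) : Prop :=
  exists s : seq (R * R),
    (forall t, t \in s -> gens t.2) /\ p = \sum_(t <- s) t.1 * t.2.

Definition edge_ideal (k : fieldType) (n : nat) (G : simple_graph 'I_n) :
    {mpoly k[n]} -> Prop :=
  ideal_gen (fun p => exists x y : 'I_n, adj G x y /\ p = 'X_x * 'X_y).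

Arguments edge_ideal k {n} G _.

(* A graded resolution  ... -> F_1 -> F_0 -> I -> 0  of an ideal I of         *)
(* R = k[x_1..x_n] by finitely generated graded free R-modules.  F_i is       *)
(* R^(frank i), viewed as row vectors, its b-th basis vector having degree    *)
(* fdeg i b; maps act by right multiplication by matrices.  The two           *)
(* homogeneity conditions say that these maps have degree 0 (a zero entry     *)
(* satisfies them for any shifts, and a nonzero entry forces the degree of    *)
(* its source to be at least that of its target).                             *)
Record graded_free_resolution (k : fieldType) (n : nat)
    (I : {mpoly k[n]} -> Prop) := GradedFreeResolution {
  frank : nat -> nat;
  fdeg : forall i, 'I_(frank i) -> nat;
  faug : 'cV[{mpoly k[n]}]_(frank 0);
  fdiff : forall i, 'M[{mpoly k[n]}]_(frank i.+1, frank i);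
  faug_homog : forall b m,
    m \in msupp (faug b 0) -> mdeg m = fdeg b;
  fdiff_homog : forall i b c m,
    m \in msupp (fdiff i b c) -> (mdeg m + fdeg c)%N = fdeg b;
  faug_image : forall p : {mpoly k[n]},
    I p <-> exists u : 'rV_(frank 0), p%:M = u *m faug;
  fexact0 : forall u : 'rV_(frank 0),
    u *m faug = 0 <-> exists w : 'rV_(frank 1), u = w *m fdiff 0;
  fexactS : forall i (u : 'rV_(frank i.+1)),
    u *m fdiff i = 0 <-> exists w : 'rV_(frank i.+2), u = w *m fdiff i.+1 }.

Section GradedTor.

Variables (k : fieldType) (n : nat) (I : {mpoly k[n]} -> Prop).
Variable F : graded_free_resolution I.

(* F_i (x)_R k is k^(frank F i), k being the quotient of R by (x_1..x_n);     *)
(* the induced differential is the reduction of fdiff modulo the variables,   *)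
(* that is, its matrix of constant coefficients.                              *)
Definition tensor_diff (i : nat) : 'M[k]_(frank F i.+1, frank F i) :=
  map_mx (mcoeff 0%MM) (fdiff F i).

(* Row space: the degree j component of F_i (x)_R k.                          *)
Definition tensor_deg (i j : nat) : 'M[k]_(frank F i) :=
  diag_mx (\row_b (fdeg b == j)%:R).

Definition tensor_cycles (i : nat) : 'M[k]_(frank F i) :=
  if i is i'.+1 then kermx (tensor_diff i') else 1%:M.

(* beta_{i,j}(I) = dim_k Tor_i(I, k)_j = dim_k H_i(F (x)_R k)_j, computed     *)
(* from the resolution F.  The subtraction on nat is not truncated, as the    *)
(* boundaries of degree j are contained in the cycles of degree j.            *)
Definition graded_betti (i j : nat) : nat :=
  (\rank (tensor_cycles i :&: tensor_deg i j)
   - \rank (tensor_diff i :&: tensor_deg i j))%N.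

End GradedTor.

(* Main.v *)
Require Import Defs.
From HB Require Import structures.
From mathcomp Require Import all_boot all_order all_algebra.
From mathcomp Require Import mpoly ring zify.

Set Implicit Arguments.
Unset Strict Implicit.
Unset Printing Implicit Defensive.

Import Order.TTheory GRing.Theory Num.Theory.

Local Open Scope ring_scope.

(** Write c(S) for the number of connected components of the complement of the
induced subgraph G_S.  The proof bounds beta_{i,i+2}(I(G)) below by the sum of
c(S) - 1 over the vertex sets S with i+2 elements, and then compares the two
sides of the inequality one set S at a time.

Algebra.  Let e_S be the Koszul basis vectors.  For a family of functions
f_S : S -> k put y_f = sum_S sum_(a in S) +-f_S(a) x_a e_(S-a).  The Koszul
boundary of y_f is a cycle whose coefficient at x_a x_b e_(S-a-b) is
+-(f_S(a) - f_S(b)).  It therefore has coefficients in I(G) exactly when every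
f_S takes equal values at non-adjacent vertices, that is, when f_S is constant
on the components of the complement of G_S; and it vanishes exactly when every
f_S is constant on S.  This yields, for each S with i+2 elements, c(S) - 1
independent Koszul cycles with coefficients in the degree 2 part of I(G).

For an arbitrary graded free resolution F of I, such a cycle z in K_i (x) I is
carried to Tor_i(I,k)_{i+2} by the usual zigzag: lift z to K_i (x) F_0, apply
the Koszul differential, lift the result to K_(i-1) (x) F_1, and so on down to
K_0 (x) F_i, where one reduces modulo the variables ([zigzag_exists]).  Lifts
can be chosen homogeneous ([homog_lift]), so the end of the zigzag has degree
i+2.  If the end is a boundary, running the zigzag backwards with the exactness
of the Koszul complex ([koszul_exact]) shows that z = kappa(y) for some y with
coefficients in I ([zigzag_injective]).  As I starts in degree 2, kappa(y) has
only coefficients of degree at least 3, whereas z has degree 2; so z = 0.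
Thus independent cycles give independent homology classes
([graded_betti_ge], [graded_betti_coroots]).

Combinatorics.  The sum of the binomials C(deg v, i+1) counts the pairs (v, S)
in which v is adjacent to all of S - v, that is, {v} is a component of the
complement of G_S ([sum_bin_degree]).  If all vertices of S are such, S is a
clique, and c(S) - 1 is this count minus 1.  Otherwise some component is not of
this kind and c(S) - 1 is at least the count.  If moreover G_S is K_{a,b} with
2 <= a <= b, the count is 0, c(S) = 2, and a is determined by S
([coroots_bound]). *)

(** * Coefficients of polynomials *)

Lemma msupp_mul (k : fieldType) (n : nat) (p q : {mpoly k[n]}) m :
  m \in msupp (p * q) ->
  exists m1 m2, [/\ m1 \in msupp p, m2 \in msupp q & m = (m1 + m2)%MM].
Proof.
by move/msuppM_le/allpairsP => [[m1 m2] /= [h1 h2 ->]]; exists m1, m2.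
Qed.

Lemma msupp_eq_empty (k : fieldType) (n : nat) (p : {mpoly k[n]}) :
  (forall m, m \notin msupp p) -> p = 0.
Proof.
by move=> p0; apply/mpolyP => m; rewrite mcoeff0; apply/eqP; rewrite mcoeff_eq0.
Qed.

Lemma lepm_mnm1 (n : nat) (a : 'I_n) (m : 'X_{1..n}) :
  (0 < m a)%N -> (U_(a) <= m)%MM.
Proof.
by move=> m_a; apply/mnm_lepP => j; rewrite mnm1E; case: eqP => // <-.
Qed.

Lemma mcoeff_mulXl (k : fieldType) (n : nat) (a : 'I_n) (p : {mpoly k[n]}) m :
  ('X_a * p)@_m = if (0 < m a)%N then p@_(m - U_(a))%MM else 0.
Proof.
have [lt_am|] := boolP (0 < m a)%N.
  have le_am := lepm_mnm1 lt_am.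
  by rewrite -[in LHS](submK le_am) addmC mulrC mcoeffMX.
rewrite -eqn0Ngt => /eqP m_a0; apply/eqP; rewrite mcoeff_eq0; apply/negP.
move/msupp_mul => [m1 [m2 [+ _ m_def]]].
rewrite msuppX inE => /eqP m1_def; move: m_a0.
by rewrite m_def m1_def mnmDE mnm1E eqxx.
Qed.

Lemma mpoly_of_coeff (k : fieldType) (n : nat) (f : 'X_{1..n} -> k)
    (s : seq 'X_{1..n}) :
  (forall m, f m != 0 -> m \in s) ->
  exists p : {mpoly k[n]}, forall m, p@_m = f m.
Proof.
move=> supp_f; exists (\sum_(m <- undup s) f m *: 'X_[m]) => m.
rewrite raddf_sum /=.
under eq_bigr => i _ do rewrite mcoeffZ mcoeffX.
have [s_m|s'm] := boolP (m \in s).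
  rewrite (bigD1_seq m) ?mem_undup ?undup_uniq //= eqxx mulr1 big1 ?addr0 //.
  by move=> i /negbTE ->; rewrite mulr0.
rewrite big_seq big1 => [|i].
  by apply/esym/eqP; apply: contraNT s'm => /supp_f.
by rewrite mem_undup => s_i; case: eqP s'm => [<-|_ _]; rewrite ?s_i ?mulr0.
Qed.

(** * The Koszul complex *)

Section Koszul.

Variables (k : fieldType) (n : nat).
Local Notation R := {mpoly k[n]}.
Implicit Types (a l : 'I_n) (T : {set 'I_n}) (m : 'X_{1..n}).

Definition num_below a T : nat := #|[set b in T | (b < a)%N]|.

(** An element of the exterior algebra on the variables, tensored with the free
module of rank r, is the family of its coefficients at the basis vectors e_T.
All homological degrees are kept together; [koszul] lowers the size of T by
one. *)
Definition koszul r (u : {set 'I_n} -> 'rV[R]_r) T : 'rV[R]_r :=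
  \sum_(a | a \notin T) ((-1) ^+ num_below a T * 'X_a) *: u (a |: T).

Lemma num_belowU1 a b T :
  b \notin T -> num_below a (b |: T) = ((b < a)%N + num_below a T)%N.
Proof.
move=> T'b; rewrite /num_below; case: (boolP (b < a)%N) => lt_ba.
  have -> : [set c in b |: T | (c < a)%N] = b |: [set c in T | (c < a)%N].
    apply/setP => c; rewrite !inE andb_orl.
    by case: eqP => [->|] //=; rewrite lt_ba.
  by rewrite cardsU1 inE (negbTE T'b).
congr #|pred_of_set _|; apply/setP => c; rewrite !inE andb_orl.
by case: eqP => [->|] //=; rewrite (negbTE lt_ba) andbF.
Qed.

(** Pairing the terms (a, b) and (b, a) exhibits the cancellation behind every
double application of the Koszul differential. *)
Lemma sum_pairs (M : zmodType) T (g : 'I_n -> 'I_n -> M) :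
  \sum_(a | a \notin T) \sum_(b | b \notin a |: T) g a b =
  \sum_(a | a \notin T) \sum_(b | (b \notin T) && (b < a)%N) (g a b + g b a).
Proof.
under [RHS]eq_bigr => a _ do rewrite big_split /=.
rewrite big_split /=.
rewrite [X in _ = _ + X](exchange_big_dep (fun b => b \notin T)) /=; last first.
  by move=> a b _ /andP[].
rewrite -big_split; apply: eq_bigr => a T'a.
rewrite (bigID (fun b : 'I_n => (b < a)%N)) /=; congr (_ + _).
  apply: eq_bigl => b; rewrite !inE negb_or.
  case: (ltngtP b a) => //=; rewrite ?andbF // andbT -val_eqE => lt_ba /=.
  by rewrite (ltn_eqF lt_ba) andbT.
apply: eq_bigl => b; rewrite !inE negb_or T'a -val_eqE /= -leqNgt.
by case: (ltngtP b a); rewrite ?andbF ?andbT.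
Qed.

Lemma koszulK r (u : {set 'I_n} -> 'rV[R]_r) T : koszul (koszul u) T = 0.
Proof.
rewrite /koszul.
under eq_bigr => a _ do (rewrite scaler_sumr;
  under eq_bigr => b _ do rewrite scalerA).
rewrite sum_pairs big1 // => a T'a; rewrite big1 // => b /andP[T'b lt_ba].
rewrite !num_belowU1 // lt_ba ltnNge (ltnW lt_ba) /= add0n add1n exprS.
by rewrite setUCA -scalerDl mulN1r [X in _ + X]mulrC !mulNr subrr scale0r.
Qed.

Lemma eq_koszul r (u v : {set 'I_n} -> 'rV[R]_r) T :
  (forall a, a \notin T -> u (a |: T) = v (a |: T)) -> koszul u T = koszul v T.
Proof. by move=> e; apply: eq_bigr => a /e ->. Qed.

Lemma koszul_mulmx r s (u : {set 'I_n} -> 'rV[R]_r) (A : 'M[R]_(r, s)) T :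
  koszul (fun S => u S *m A) T = koszul u T *m A.
Proof.
by rewrite /koszul mulmx_suml; apply: eq_bigr => a _; rewrite scalemxAl.
Qed.

Lemma koszulB r (u v : {set 'I_n} -> 'rV[R]_r) T :
  koszul (fun S => u S - v S) T = koszul u T - koszul v T.
Proof. by rewrite -sumrB; apply: eq_bigr => a _; rewrite scalerBr. Qed.

Lemma koszul_sum r (J : finType) (c : J -> R)
    (u : J -> {set 'I_n} -> 'rV[R]_r) T :
  koszul (fun S => \sum_j c j *: u j S) T = \sum_j c j *: koszul (u j) T.
Proof.
rewrite /koszul; under [RHS]eq_bigr => j _ do rewrite scaler_sumr.
rewrite exchange_big; apply: eq_bigr => a _; rewrite scaler_sumr.
by apply: eq_bigr => j _; rewrite !scalerA mulrC.
Qed.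

Lemma koszul_coeff r (u : {set 'I_n} -> 'rV[R]_r) T (b : 'I_r) m :
  (koszul u T 0 b)@_m =
  \sum_(a | a \notin T) (-1) ^+ num_below a T *
    (if (0 < m a)%N then (u (a |: T) 0 b)@_(m - U_(a))%MM else 0).
Proof.
rewrite summxE raddf_sum /=; apply: eq_bigr => a _.
by rewrite mxE -mulrA raddfMsign /= mcoeff_mulXl.
Qed.

(** The variable l is the least one occurring in the multidegree of x^m e_T. *)
Definition first_var l T m :=
  [&& (l \in T) || (0 < m l)%N &
      [forall a : 'I_n, (a < l)%N ==> (a \notin T) && (m a == 0%N)]].

Lemma first_var_uniq l l' T m : first_var l T m -> first_var l' T m -> l = l'.
Proof.
move=> /andP[h1 /forallP h2] /andP[h1' /forallP h2']; apply/val_inj.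
case: (ltngtP l l') => // lt.
  by move: (h2' l) h1; rewrite lt /= => /andP[/negbTE -> /eqP ->].
by move: (h2 l') h1'; rewrite lt /= => /andP[/negbTE -> /eqP ->].
Qed.

Lemma first_var_exists T m : (T != set0) || (m != 0%MM) ->
  exists l, first_var l T m.
Proof.
move=> nz; have [l0 Pl0] : exists l, (l \in T) || (0 < m l)%N.
  case/orP: nz => [/set0Pn[l Tl]|nz]; first by exists l; rewrite Tl.
  apply/existsP; apply: contraNT nz; rewrite negb_exists => /forallP m0.
  apply/eqP/mnmP => l; rewrite mnm0E; move: (m0 l).
  by rewrite negb_or -eqn0Ngt => /andP[_ /eqP].
case: (@arg_minnP _ l0 (fun l => (l \in T) || (0 < m l)%N) (@nat_of_ord n) Pl0).
move=> l Pl min_l; exists l; rewrite /first_var Pl /=.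
apply/forallP => a; apply/implyP => lt_al.
have : ~~ ((a \in T) || (0 < m a)%N).
  by apply: contraTN lt_al => /min_l; rewrite -leqNgt.
by rewrite negb_or -eqn0Ngt.
Qed.

(** The Koszul differential preserves multidegrees, and hence their least
variable. *)
Lemma first_var_shift l a T m : a \notin T -> (0 < m a)%N ->
  first_var l T m -> first_var l (a |: T) (m - U_(a))%MM.
Proof.
move=> T'a m_a /andP[Pl /forallP lt_l]; apply/andP; split.
  rewrite !inE; case: eqVneq => //= ne_la; rewrite mnmBE mnm1E.
  by rewrite [a == l]eq_sym (negbTE ne_la) subn0.
apply/forallP => b; apply/implyP => lt_bl; move: (lt_l b); rewrite lt_bl /=.
rewrite !inE mnmBE => /andP[/negbTE -> /eqP m_b0]; rewrite m_b0 sub0n eqxx.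
by rewrite orbF andbT; apply: contraTneq m_a => <-; rewrite m_b0.
Qed.

(** In each multidegree the Koszul complex is the augmented chain complex of a
simplex, whose vertices are the variables occurring in it.  Coning from the
least variable l contracts it in every characteristic: x^m e_T goes to
x^m/x_l e_(T+l) if T does not contain l, and to 0 otherwise; no sign arises
since l precedes every element of T.  The only multidegree without a variable
is that of 1 at the empty set, and its coefficient is assumed to vanish. *)
Lemma koszul_exact r (v : {set 'I_n} -> 'rV[R]_r) :
  (forall T, koszul v T = 0) -> (forall b, (v set0 0 b)@_0%MM = 0) ->
  exists w, forall T, v T = koszul w T.
Proof.
move=> cycle_v v0.
(* The coefficient at x^m e_T of the image of v under this contraction. *)
pose g T b m := if [pick l | first_var l T m] is Some l then
  if l \in T then (v (T :\ l) 0 b)@_(m + U_(l))%MM else 0 else 0.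
have gE l T b m : first_var l T m ->
    g T b m = if l \in T then (v (T :\ l) 0 b)@_(m + U_(l))%MM else 0.
  move=> fl; rewrite /g; case: pickP => [l' fl'|/(_ l)]; last by rewrite fl.
  by rewrite (first_var_uniq fl' fl).
have [w wE] : exists w : {set 'I_n} -> 'I_r -> R,
    forall T b m, (w T b)@_m = g T b m.
  apply: (fin_all_exists (P := fun T (p : 'I_r -> R) =>
    forall b m, (p b)@_m = g T b m)) => T.
  apply: (fin_all_exists (P := fun b (p : R) => forall m, p@_m = g T b m)) => b.
  apply: (@mpoly_of_coeff _ _ _ (flatten [seq [seq (m' - U_(l))%MM |
    m' <- msupp (v (T :\ l) 0 b)] | l <- enum 'I_n])) => m.
  rewrite /g; case: pickP => [l fl|_]; last by rewrite eqxx.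
  case: ifP => [Tl nz|]; last by rewrite eqxx.
  apply/flatten_mapP; exists l; first by rewrite mem_enum.
  by apply/mapP; exists (m + U_(l))%MM; rewrite ?mcoeff_msupp // addmK.
exists (fun T => \row_b w T b) => T; apply/rowP => b; apply/mpolyP => m.
rewrite koszul_coeff; under eq_bigr => a _ do rewrite mxE wE.
have [nz|] := boolP ((T != set0) || (m != 0%MM)); last first.
  rewrite negb_or !negbK => /andP[/eqP -> /eqP ->]; rewrite v0 big1 // => a _.
  by rewrite mnm0E ltnn mulr0.
have [l fl] := first_var_exists nz.
have [lT|l'T] := boolP (l \in T); last first.
  rewrite (bigD1 l) //= big1 ?addr0 => [|a /andP[T'a ne_al]].
    have m_l : (0 < m l)%N by case/andP: fl; rewrite (negbTE l'T).
    rewrite m_l (gE l) ?first_var_shift // setU11 setU1K //.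
    have -> : num_below l T = 0%N.
      apply/eqP; rewrite cards_eq0; apply/eqP/setP => a; rewrite !inE.
      apply/negP => /andP[Ta lt_al].
      by case/andP: fl => _ /forallP/(_ a); rewrite lt_al Ta.
    by rewrite mul1r submK // lepm_mnm1.
  case: ifP => [m_a|_]; last by rewrite mulr0.
  rewrite (gE l) ?first_var_shift // !inE (negbTE l'T) orbF eq_sym.
  by rewrite (negbTE ne_al) mulr0.
(* With l in T, v_T is recovered from the cycle condition at T - l: the term of
   that condition that adds l back is v_T, and the others form koszul w. *)
have := congr1 (fun x : 'rV[R]_r => (x 0 b)@_(m + U_(l))%MM) (cycle_v (T :\ l)).
rewrite koszul_coeff mxE mcoeff0 (bigD1 l) ?setD11 //=.
have lt_l a : (a < l)%N -> (a \notin T) /\ m a = 0%N.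
  move=> lt_al; case/andP: fl => _ /forallP/(_ a).
  by rewrite lt_al => /andP[-> /eqP].
have -> : num_below l (T :\ l) = 0%N.
  apply/eqP; rewrite cards_eq0; apply/eqP/setP => a; rewrite !inE.
  by apply/negP => /andP[/andP[_ Ta] /lt_l []]; rewrite Ta.
rewrite mul1r mnmDE mnm1E eqxx addn1 /= setD1K // addmK.
move/eqP; rewrite addr_eq0 => /eqP ->; rewrite -sumrN.
have T_def : l |: (T :\ l) = T by rewrite setD1K.
apply: eq_big => a.
  by rewrite !inE; case: eqVneq => [->|]; rewrite ?lT ?andbT.
move=> /andP[T'a ne_al].
have {}T'a : a \notin T by move: T'a; rewrite !inE ne_al.
rewrite mnmDE mnm1E [l == a]eq_sym (negbTE ne_al) addn0.
case: ifP => [m_a|_]; last by rewrite !mulr0 oppr0.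
rewrite (gE l) ?first_var_shift // !inE lT orbT.
have lt_la : (l < a)%N.
  case: (ltngtP a l) => // [/lt_l [_ m_a0]|e]; first by rewrite m_a0 in m_a.
  by move: ne_al; rewrite -val_eqE /= e eqxx.
have -> : num_below a T = (num_below a (T :\ l)).+1.
  by rewrite -[in LHS]T_def num_belowU1 ?setD11 // lt_la.
rewrite exprS mulN1r mulNr.
congr (- (_ * _)); congr (mcoeff _ (v _ _ _)).
  rewrite addmC [in RHS]addmC; apply/mnmP => j; rewrite !(mnmBE, mnmDE, mnm1E).
  case: (eqVneq a j) => [<-|_]; last by rewrite !subn0.
  by rewrite [l == a]eq_sym (negbTE ne_al).
apply/setP => j; rewrite !inE; case: (eqVneq j l) => //= ->.
by rewrite eq_sym (negbTE ne_al).
Qed.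

End Koszul.

(** * Homogeneous row vectors *)

(** Homogeneity of degree D in the graded free module whose b-th generator has
degree fd b; the zero vector satisfies it for every D. *)
Definition graded (k : fieldType) (n r : nat) (D : nat) (fd : 'I_r -> nat)
    (u : 'rV[{mpoly k[n]}]_r) :=
  forall b m, m \in msupp (u 0 b) -> (mdeg m + fd b)%N = D.

Lemma homog0 (k : fieldType) (n r D : nat) (fd : 'I_r -> nat) :
  graded D fd (0 : 'rV[{mpoly k[n]}]_r).
Proof. by move=> b m; rewrite mxE msupp0. Qed.

Lemma msupp_sum_ex (k : fieldType) (n : nat) (J : finType) (P : pred J)
    (p : J -> {mpoly k[n]}) m :
  m \in msupp (\sum_(j | P j) p j) -> exists2 j, P j & m \in msupp (p j).
Proof.
move=> m_in; have /existsP[j /andP[]] : [exists j, P j && (m \in msupp (p j))].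
  apply: contraTT m_in; rewrite negb_exists => /forallP no_m.
  rewrite -mcoeff_eq0 raddf_sum big1 //= => j Pj; apply/eqP.
  by move: (no_m j); rewrite Pj /= mcoeff_eq0.
by exists j.
Qed.

Section HomogeneousMatrix.

Variables (k : fieldType) (n r s : nat) (A : 'M[{mpoly k[n]}]_(r, s)).
Variables (fd : 'I_r -> nat) (gd : 'I_s -> nat).
Hypothesis homogA : forall b c m,
  m \in msupp (A b c) -> (mdeg m + gd c)%N = fd b.

Lemma msupp_mulmx (u : 'rV_r) c m : m \in msupp ((u *m A) 0 c) ->
  exists b m', m' \in msupp (u 0 b) /\ (mdeg m + gd c = mdeg m' + fd b)%N.
Proof.
rewrite mxE => /msupp_sum_ex[b _ /msupp_mul[m1 [m2 [m1_in m2_in ->]]]].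
by exists b, m1; rewrite mdegD -addnA (homogA m2_in).
Qed.

Lemma homog_mulmx D (u : 'rV_r) : graded D fd u -> graded D gd (u *m A).
Proof. by move=> hu c m /msupp_mulmx[b [m' [/hu <- ->]]]. Qed.

(** Of any lift w, the components of degree D form a lift: the other components
contribute nothing of degree D to the product. *)
Lemma homog_lift D (w : 'rV_r) : graded D gd (w *m A) ->
  exists2 w', graded D fd w' & w *m A = w' *m A.
Proof.
move=> hwA.
have [p pE] : exists p : 'I_r -> {mpoly k[n]}, forall b m,
    (p b)@_m = if (mdeg m + fd b == D)%N then (w 0 b)@_m else 0.
  apply: (fin_all_exists (P := fun b (q : {mpoly k[n]}) => forall m,
    q@_m = if (mdeg m + fd b == D)%N then (w 0 b)@_m else 0)) => b.
  apply: (@mpoly_of_coeff _ _ _ (msupp (w 0 b))) => m.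
  by case: ifP => _; rewrite ?eqxx // mcoeff_msupp.
have hp : graded D fd (\row_b p b).
  move=> b m; rewrite mxE mcoeff_msupp pE.
  by case: ifP => [/eqP //|_]; rewrite eqxx.
exists (\row_b p b) => //.
apply/eqP; rewrite -subr_eq0 -mulmxBl; apply/eqP/rowP => c; rewrite [RHS]mxE.
apply: msupp_eq_empty => m; apply/negP => m_in.
have [b [m' []]] := msupp_mulmx m_in.
rewrite mcoeff_msupp !mxE mcoeffB pE; case: ifP => [_|ne _ mE].
  by rewrite subrr eqxx.
case/eqP: ne; rewrite -mE; move: m_in; rewrite mulmxBl mxE => /msuppD_le.
rewrite mem_cat => /orP[/hwA//|].
rewrite mcoeff_msupp mxE mcoeffN oppr_eq0 -mcoeff_msupp.
exact: (homog_mulmx hp).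
Qed.

End HomogeneousMatrix.

Lemma homog_koszul (k : fieldType) (n r D : nat) (fd : 'I_r -> nat)
    (u : {set 'I_n} -> 'rV[{mpoly k[n]}]_r) T :
  (forall S, graded D fd (u S)) -> graded D.+1 fd (koszul u T).
Proof.
move=> hu b m; rewrite mcoeff_msupp; apply: contraNeq => neD.
rewrite koszul_coeff big1 // => a T'a.
case: ifP => [m_a|]; last by rewrite mulr0.
case: (eqVneq (u (a |: T) 0 b)@_(m - U_(a))%MM 0) => [->|].
  by rewrite mulr0.
rewrite -mcoeff_msupp => /hu hD; case/eqP: neD; rewrite -hD.
have le_am := lepm_mnm1 m_a.
by rewrite -{1}(submK le_am) mdegD mdeg1 addn1 addSn.
Qed.

(** * From Koszul cycles to the homology of a resolution *)

Section Zigzag.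

Variables (k : fieldType) (n : nat) (I : {mpoly k[n]} -> Prop).
Variable F : graded_free_resolution I.
Local Notation R := {mpoly k[n]}.
Implicit Types (T : {set 'I_n}) (z : {set 'I_n} -> 'rV[R]_1).

(** The element u of K (x) F_j is joined to the element z of K (x) I by a chain
of elements of K (x) F_0, ..., K (x) F_j, the Koszul differential of each being
the image of the next.  The vanishing of the intermediate elements at the empty
set says that they have no component of Koszul degree 0, the only degree in
which the Koszul complex is not exact. *)
Fixpoint zigzag j z : ({set 'I_n} -> 'rV[R]_(frank F j)) -> Prop :=
  match j return ({set 'I_n} -> 'rV[R]_(frank F j)) -> Prop with
  | 0 => fun u => forall T, z T = u T *m faug F
  | j'.+1 => fun u => exists u' : {set 'I_n} -> 'rV[R]_(frank F j'),
      [/\ zigzag z u', u' set0 = 0 & forall T, koszul u' T = u T *m fdiff F j']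
  end.

(** The two differentials commute, and the Koszul differential squares to 0, so
that the end of a zigzag can always be continued. *)
Lemma zigzag_next j z (u : {set 'I_n} -> 'rV[R]_(frank F j)) T :
  (forall S, koszul z S = 0) -> zigzag z u ->
  exists w, koszul u T = w *m fdiff F j.
Proof.
case: j u => [|j] u cyc_z.
  move=> zu; apply/(fexact0 (g := F)); rewrite -koszul_mulmx -[RHS](cyc_z T).
  by apply: eq_koszul => a _; rewrite zu.
case=> u' [_ _ uE]; apply/(fexactS (g := F)); rewrite -koszul_mulmx.
rewrite -[RHS](koszulK u' T).
by apply: eq_koszul => a _; rewrite uE.
Qed.

Lemma zigzag_exists i z :
  (forall T, koszul z T = 0) -> (forall T, I (z T 0 0)) ->
  (forall T, #|T| != i -> z T = 0) -> (forall T, graded 2 (fun=> 0%N) (z T)) ->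
  forall j p, (p + j)%N = i ->
  exists u : {set 'I_n} -> 'rV[R]_(frank F j),
    [/\ zigzag z u, forall T, #|T| != p -> u T = 0 &
        forall T, graded (j + 2) (@fdeg _ _ _ F j) (u T)].
Proof.
move=> cyc_z Iz supp_z hom_z; elim=> [|j IH] p.
  rewrite addn0 => ->.
  have /fin_all_exists[u uE] T : exists uT, [/\ z T = uT *m faug F,
      #|T| != i -> uT = 0 & graded 2 (@fdeg _ _ _ F 0) uT].
    have [Ti|nTi] := eqVneq #|T| i; last first.
      exists 0; split=> //; last exact: homog0.
      by rewrite mul0mx supp_z.
    have /(faug_image F)[w wE] := Iz T.
    have hA (b : 'I_(frank F 0)) (c : 'I_1) m : m \in msupp (faug F b c) ->
      (mdeg m + 0)%N = fdeg b.
      by rewrite ord1 addn0; exact: faug_homog.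
    have zw : z T = w *m faug F by rewrite -wE -mx11_scalar.
    have := hom_z T; rewrite zw => /(homog_lift hA)[w' hw' ->].
    by exists w'.
  by exists u; split=> T; case: (uE T).
rewrite addnS => pj; have [u' [zu' supp_u' hom_u']] := IH p.+1 pj.
have /fin_all_exists[u uE] T : exists uT, [/\ koszul u' T = uT *m fdiff F j,
    #|T| != p -> uT = 0 & graded (j.+1 + 2) (@fdeg _ _ _ F j.+1) uT].
  have [Tp|nTp] := eqVneq #|T| p; last first.
    exists 0; split=> //; last exact: homog0.
    rewrite mul0mx /koszul big1 // => a T'a.
    by rewrite supp_u' ?scaler0 // cardsU1 T'a.
  have [w wE] := zigzag_next T cyc_z zu'.
  have := @homog_koszul k n _ (j + 2) _ u' T hom_u'; rewrite wE.
  move=> /(homog_lift (@fdiff_homog _ _ _ F j))[w' hw' ->].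
  by exists w'.
exists u; split=> [|T|T]; last 2 first.
- by case: (uE T).
- by case: (uE T).
by exists u'; split=> // [|T]; [apply: supp_u'; rewrite cards0 | case: (uE T)].
Qed.

Lemma zigzag_sum (J : finType) (c : J -> R) j (z : J -> {set 'I_n} -> 'rV[R]_1)
    (u : J -> {set 'I_n} -> 'rV[R]_(frank F j)) :
  (forall l, zigzag (z l) (u l)) ->
  zigzag (fun T => \sum_l c l *: z l T) (fun T => \sum_l c l *: u l T).
Proof.
elim: j u => [|j IH] u /=.
  move=> zu T; rewrite mulmx_suml; apply: eq_bigr => l _.
  by rewrite -scalemxAl zu.
move=> /fin_all_exists[u' zu']; exists (fun T => \sum_l c l *: u' l T); split.
- by apply: IH => l; case: (zu' l).
- by rewrite big1 // => l _; case: (zu' l) => _ -> _; rewrite scaler0.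
move=> T; rewrite koszul_sum mulmx_suml; apply: eq_bigr => l _.
by rewrite -scalemxAl; case: (zu' l) => _ _ ->.
Qed.

(** A zigzag whose end is a sum of a boundary of F and a Koszul boundary starts
at a Koszul boundary with coefficients in I: if u = d w + kappa w', then the
previous element differs from d w' by a Koszul cycle, which is a Koszul
boundary, so that the previous element has the same form. *)
Lemma zigzag_boundary j z (u : {set 'I_n} -> 'rV[R]_(frank F j)) w w' :
  zigzag z u -> (forall T, u T = w T *m fdiff F j + koszul w' T) ->
  exists2 y : {set 'I_n} -> 'rV[R]_1,
    forall T, I (y T 0 0) & forall T, z T = koszul y T.
Proof.
elim: j u w w' => [|j IH] u w w' /=.
  move=> zu uE; exists (fun T => w' T *m faug F) => T.
    by apply/(faug_image F); exists (w' T); rewrite -mx11_scalar.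
  rewrite zu uE mulmxDl koszul_mulmx.
  have -> : w T *m fdiff F 0 *m faug F = 0.
    by apply/(fexact0 (g := F)); exists (w T).
  by rewrite add0r.
move=> [u' [zu' u'0 uE']] uE.
(* Koszul exactness at S = set0 needs a vanishing constant term there, and
   kappa w' does not depend on the value of w' at set0. *)
pose w'' S := if S == set0 then 0 else w' S.
have w''E a T : w'' (a |: T) = w' (a |: T).
  by rewrite /w''; case: eqP => // /setP/(_ a); rewrite !inE eqxx.
have [y yE] : exists y, forall T, u' T - w'' T *m fdiff F j = koszul y T.
  apply: koszul_exact => [T|b]; last first.
    by rewrite /w'' eqxx mul0mx subr0 u'0 mxE mcoeff0.
  rewrite koszulB koszul_mulmx uE' uE mulmxDl.
  have -> : w T *m fdiff F j.+1 *m fdiff F j = 0.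
    by apply/(fexactS (g := F)); exists (w T).
  rewrite add0r (_ : koszul w'' T = koszul w' T) ?subrr //.
  by apply: eq_koszul => a _; exact: w''E.
by apply: (IH u' w'' y zu') => T; rewrite -yE addrC subrK.
Qed.

Local Notation residue := (map_mx (mcoeff 0%MM)).

(** If the reduction of u modulo the variables is the boundary of c, then
u - d c has no constant terms; being in Koszul degree 0, it is a Koszul
boundary, and [zigzag_boundary] applies. *)
Lemma zigzag_injective i z (u : {set 'I_n} -> 'rV[R]_(frank F i)) :
  zigzag z u -> (forall T, #|T| != 0%N -> u T = 0) ->
  (residue (u set0) <= tensor_diff F i)%MS ->
  exists2 y : {set 'I_n} -> 'rV[R]_1,
    forall T, I (y T 0 0) & forall T, z T = koszul y T.
Proof.
move=> zu supp_u /submxP[c cE].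
pose w T : 'rV[R]_(frank F i.+1) :=
  if T == set0 then map_mx (@mpolyC n k) c else 0.
have wU a T : w (a |: T) = 0.
  by rewrite /w; case: eqP => // /setP/(_ a); rewrite !inE eqxx.
have [y yE] : exists y, forall T, u T - w T *m fdiff F i = koszul y T.
  apply: koszul_exact => [T|b].
    rewrite /koszul big1 // => a T'a.
    by rewrite wU mul0mx subr0 supp_u ?scaler0 // cardsU1 T'a.
  rewrite mxE mcoeffD; have /rowP/(_ b) := cE; rewrite mxE => ->.
  rewrite !mxE mcoeffN raddf_sum /= -sumrB big1 // => l _.
  by rewrite /w eqxx !mxE mcoeffCM subrr.
by apply: (@zigzag_boundary _ _ _ w y zu) => T; rewrite -yE addrC subrK.
Qed.

Lemma tensor_diff_cycles i : (tensor_diff F i <= tensor_cycles F i)%MS.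
Proof.
case: i => [|i] /=; first exact: submx1.
apply/sub_kermxP; rewrite /tensor_diff -map_mxM.
suff -> : fdiff F i.+1 *m fdiff F i = 0 by rewrite map_mx0.
apply/row_matrixP => b; rewrite row_mul row0.
by apply/(fexactS (g := F)); exists (delta_mx 0 b); rewrite rowE.
Qed.

(** Koszul boundaries have no constant terms. *)
Lemma residue_cycle i (u : {set 'I_n} -> 'rV[R]_(frank F i)) z : zigzag z u ->
  (residue (u set0) <= tensor_cycles F i)%MS.
Proof.
case: i u => [|i] u /=; first by rewrite submx1.
move=> [u' [_ _ uE]]; apply/sub_kermxP; rewrite /tensor_diff -map_mxM -uE.
apply/rowP => b; rewrite [LHS]mxE [RHS]mxE /= koszul_coeff big1 // => a _.
by rewrite mnm0E ltnn mulr0.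
Qed.

Lemma residue_degree i D (u : 'rV[R]_(frank F i)) :
  graded D (@fdeg _ _ _ F i) u -> (residue u <= tensor_deg F i D)%MS.
Proof.
move=> hu; apply/submxP; exists (residue u); rewrite mul_mx_diag.
apply/rowP => b; rewrite !mxE.
case: eqVneq => [_|neD]; first by rewrite mulr1.
rewrite mulr0; apply: contraNeq neD; rewrite -mcoeff_msupp => /hu.
by rewrite mdeg0 add0n => ->.
Qed.

(** The zigzag construction maps the space of linear Koszul cycles with
coefficients in I injectively into Tor_i(I, k)_{i+2}.  No nonzero cycle of this
kind is the Koszul boundary of a chain with coefficients in I, because I starts
in degree 2. *)
Lemma graded_betti_ge N (z : 'I_N -> {set 'I_n} -> 'rV[R]_1) i :
  (forall p m, I p -> m \in msupp p -> (2 <= mdeg m)%N) ->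
  (forall j T, koszul (z j) T = 0) -> (forall j T, I (z j T 0 0)) ->
  (forall j T, #|T| != i -> z j T = 0) ->
  (forall j T, graded 2 (fun=> 0%N) (z j T)) ->
  (forall c : 'I_N -> k, (forall T, \sum_j (c j)%:MP *: z j T = 0) ->
     forall j, c j = 0) ->
  (N <= graded_betti F i (i + 2))%N.
Proof.
move=> I_ge2 cyc_z Iz supp_z hom_z free_z.
have /fin_all_exists[u uE] j := zigzag_exists (cyc_z j) (Iz j) (supp_z j)
  (hom_z j) (add0n i).
pose U : 'M[k]_(N, frank F i) := \matrix_j residue (u j set0).
have U_B (c : 'rV_N) : (c *m U <= tensor_diff F i)%MS -> c = 0.
  move=> cU; apply/rowP => j; rewrite [RHS]mxE.
  move: j; apply: free_z => T.
  have zs := zigzag_sum (fun j => (c 0 j)%:MP)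
    (fun j => let: And3 h _ _ := uE j in h).
  have [|| y Iy yE] := zigzag_injective zs.
  - move=> S S0; rewrite big1 // => j _.
    by case: (uE j) => _ -> //; rewrite scaler0.
  - rewrite (_ : residue _ = c *m U) //; apply/rowP => b.
    rewrite !mxE summxE raddf_sum.
    by apply: eq_bigr => j _; rewrite !mxE /= mcoeffCM.
  apply/rowP => b; rewrite [RHS]mxE.
  apply: msupp_eq_empty => m; apply/negP => m_in.
  (* m has degree 2 as a monomial of z, but degree at least 3 as a monomial of
     the Koszul boundary of y. *)
  have : mdeg m = 2.
    have := m_in; rewrite summxE => /msupp_sum_ex[j _].
    rewrite mxE mcoeff_msupp mcoeffCM mulf_eq0 negb_or => /andP[_].
    by rewrite -mcoeff_msupp => /hom_z; rewrite addn0.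
  move: m_in; rewrite yE mcoeff_msupp koszul_coeff => nz m2.
  case/eqP: nz; rewrite big1 // => a T'a.
  case: ifP => [m_a|]; last by rewrite mulr0.
  apply/eqP; rewrite mulf_eq0; apply/orP; right; rewrite ord1.
  rewrite mcoeff_eq0; apply/negP => /(I_ge2 _ _ (Iy _)).
  have le_am := lepm_mnm1 m_a.
  by move: m2; rewrite -{1}(submK le_am) mdegD mdeg1 addn1 => -[->].
have rankU : \rank U = N.
  by apply/eqP/inj_row_free => c cU0; apply: U_B; rewrite cU0 sub0mx.
set Z := tensor_cycles F i; set B := tensor_diff F i.
set D := tensor_deg F i (i + 2).
have UB0 : (U :&: (B :&: D))%MS = 0.
  apply/eqP/rowV0P => v; rewrite !sub_capmx => /and3P[/submxP[c ->]].
  by move/U_B ->; rewrite mul0mx.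
have UZD : (U <= Z :&: D)%MS.
  apply/row_subP => j; rewrite rowK sub_capmx; case: (uE j) => zu _ hu.
  by rewrite (residue_cycle zu) residue_degree.
rewrite /graded_betti -/Z -/B -/D leq_subRL; last first.
  by apply: mxrankS; apply: capmxS => //; apply: tensor_diff_cycles.
rewrite -rankU addnC -(mxrank_disjoint_sum UB0); apply: mxrankS.
rewrite addsmx_sub UZD /=; apply: capmxS => //; exact: tensor_diff_cycles.
Qed.

End Zigzag.

(** * Koszul cycles from functions on vertex sets *)

Section PotentialCycles.

Variables (k : fieldType) (n : nat).
Local Notation R := {mpoly k[n]}.
Implicit Types (f : {set 'I_n} -> 'I_n -> k) (T S : {set 'I_n}).

(** The part of the Koszul boundary of e_S at which a is removed, weighted by
f S a and summed over all S and a.  The Koszul boundary of this chain measures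
the differences of the values f S a, as [potential_cycleE] shows. *)
Definition potential f T : 'rV[R]_1 :=
  (\sum_(a | a \notin T)
     (-1) ^+ num_below a T * ((f (a |: T) a)%:MP * 'X_a))%:M.

Definition potential_cycle f := koszul (potential f).

Lemma potential_cycleE f T : potential_cycle f T 0 0 =
  \sum_(a | a \notin T) \sum_(b | (b \notin T) && (b < a)%N)
    (-1) ^+ (num_below a T + num_below b T) *
    ((f (a |: (b |: T)) b - f (a |: (b |: T)) a)%:MP * ('X_a * 'X_b)).
Proof.
rewrite /potential_cycle /koszul summxE.
under eq_bigr => a _ do rewrite !mxE eqxx mulr1n mulr_sumr.
rewrite sum_pairs; apply: eq_bigr => a T'a.
apply: eq_bigr => b /andP[T'b lt_ba].
rewrite !num_belowU1 // lt_ba ltnNge (ltnW lt_ba) /= add0n add1n exprS.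
rewrite [b |: (a |: T)]setUCA exprD mpolyCB.
set x := (-1) ^+ _; set y := (-1) ^+ _.
by ring.
Qed.

Lemma potential_cycle_supp f i T :
  (forall S a, #|S| != (i + 2)%N -> f S a = 0) -> #|T| != i ->
  potential_cycle f T = 0.
Proof.
move=> supp_f nTi; apply/rowP => b; rewrite ord1 potential_cycleE mxE.
rewrite big1 // => a T'a; rewrite big1 // => c /andP[T'c lt_ca].
rewrite !supp_f ?subrr ?mul0r ?mulr0 //.
all: rewrite !cardsU1 !inE (negbTE T'a) (negbTE T'c) /= orbF.
all: by rewrite -val_eqE /= (gtn_eqF lt_ca) addnA addnC eqn_add2r.
Qed.

Lemma graded_potential_cycle f T : graded 2 (fun=> 0%N) (potential_cycle f T).
Proof.
move=> b m; rewrite ord1 potential_cycleE addn0.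
move=> /msupp_sum_ex[a _ /msupp_sum_ex[c _]].
rewrite mcoeff_msupp raddfMsign mulf_eq0 signr_eq0 /= mcoeffCM mulf_eq0.
rewrite negb_or => /andP[_]; rewrite -mpolyXD mcoeffX.
by case: (_ =P m) => [<- _|]; rewrite ?eqxx // mdegD !mdeg1.
Qed.

Lemma potential_cycle_sum (J : finType) (c : J -> k)
    (f : J -> {set 'I_n} -> 'I_n -> k) T :
  \sum_j (c j)%:MP *: potential_cycle (f j) T =
  potential_cycle (fun S a => \sum_j c j * f j S a) T.
Proof.
rewrite /potential_cycle -koszul_sum; apply: eq_koszul => a _.
apply/rowP => b; rewrite ord1 summxE !mxE eqxx mulr1n.
under eq_bigr => j _ do rewrite !mxE eqxx mulr1n mulr_sumr.
rewrite exchange_big; apply: eq_bigr => d _.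
rewrite raddf_sum mulr_suml mulr_sumr.
by apply: eq_bigr => j _; rewrite /= mpolyCM mulrCA !mulrA.
Qed.

Lemma mnm_pair_inj (a b c d : 'I_n) : (b < a)%N -> (d < c)%N ->
  (U_(a) + U_(b))%MM = (U_(c) + U_(d))%MM -> (a = c) /\ (b = d).
Proof.
move=> lt_ba lt_dc e.
have ea := congr1 (fun m : 'X_{1..n} => m a) e.
have eb := congr1 (fun m : 'X_{1..n} => m b) e.
move: ea eb; rewrite /= !mnmDE !mnm1E !eqxx -!val_eqE /=.
rewrite (ltn_eqF lt_ba) (gtn_eqF lt_ba).
case: (eqVneq (c : nat) a) => [ca|_].
  rewrite -ca in lt_ba *; rewrite (gtn_eqF lt_ba).
  by case: (eqVneq (d : nat) b) => // db _ _; split; apply/val_inj.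
case: (eqVneq (d : nat) a) => // da _.
case: (eqVneq (d : nat) b) => [db|_]; first by move: lt_ba; rewrite -da db ltnn.
case: (eqVneq (c : nat) b) => // cb.
by move: lt_dc; rewrite cb da ltnNge (ltnW lt_ba).
Qed.

(** Reading off the coefficient at x_a x_b e_(S-a-b), to which no other pair of
variables contributes. *)
Lemma potential_cycle_eq0 f S a b : (forall T, potential_cycle f T = 0) ->
  a \in S -> b \in S -> f S a = f S b.
Proof.
move=> f0; wlog lt_ba : a b / (b < a)%N => [wl|] Sa Sb.
  case: (ltngtP a b) => [lt|lt|/val_inj -> //]; last exact: wl.
  by apply/esym; apply: wl.
pose T := S :\: [set a; b].
have T'a : a \notin T by rewrite !inE eqxx.
have T'b : b \notin T by rewrite !inE eqxx orbT.
have ST : a |: (b |: T) = S.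
  apply/setP => c; rewrite !inE.
  by case: (eqVneq c a) => [->|_] //=; case: (eqVneq c b) => [->|].
have := congr1 (fun v : 'rV[R]_1 => (v 0 0)@_(U_(a) + U_(b))%MM) (f0 T).
rewrite potential_cycleE mxE mcoeff0.
have coefE c d : ((-1) ^+ (num_below c T + num_below d T) *
    ((f (c |: (d |: T)) d - f (c |: (d |: T)) c)%:MP * ('X_c * 'X_d)) : R)@_
    (U_(a) + U_(b))%MM = (-1) ^+ (num_below c T + num_below d T) *
    ((f (c |: (d |: T)) d - f (c |: (d |: T)) c) *
      ((U_(c) + U_(d))%MM == (U_(a) + U_(b))%MM)%:R).
  by rewrite raddfMsign /= mcoeffCM -mpolyXD mcoeffX.
rewrite raddf_sum (bigD1 a) //= raddf_sum (bigD1 b) /=; last first.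
  by rewrite T'b lt_ba.
rewrite coefE eqxx mulr1 ST.
rewrite big1 => [|d /andP[/andP[_ lt_da] ne_db]]; last first.
  rewrite coefE; case: eqP => [|_]; last by rewrite !mulr0.
  by case/(mnm_pair_inj lt_da lt_ba) => _ e; rewrite e eqxx in ne_db.
rewrite big1 => [|c /andP[_ ne_ca]]; last first.
  rewrite raddf_sum big1 // => d /andP[_ lt_dc] /=; rewrite coefE.
  case: eqP => [|_]; last by rewrite !mulr0.
  by case/(mnm_pair_inj lt_dc lt_ba) => e _; rewrite e eqxx in ne_ca.
rewrite !addr0 => /eqP; rewrite mulf_eq0 signr_eq0 /= subr_eq0 => /eqP.
by [].
Qed.

End PotentialCycles.

(** * Edge ideals *)

Lemma ideal_gen_sum (R : comNzRingType) (gens : R -> Prop) (J : finType)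
    (P : pred J) (p : J -> R) :
  (forall j, P j -> ideal_gen gens (p j)) ->
  ideal_gen gens (\sum_(j | P j) p j).
Proof.
move=> gen_p; apply: big_ind => // [|x y [s [gs ->]] [t [gt ->]]].
  by exists [::]; rewrite big_nil.
exists (s ++ t); rewrite big_cat; split=> // q.
by rewrite mem_cat => /orP[/gs|/gt].
Qed.

Lemma ideal_gen_mull (R : comNzRingType) (gens : R -> Prop) (p q : R) :
  gens q -> ideal_gen gens (p * q).
Proof.
move=> gq; exists [:: (p, q)]; rewrite big_seq1; split=> // t.
by rewrite inE => /eqP ->.
Qed.

Lemma edge_ideal_mdeg (k : fieldType) (n : nat) (G : simple_graph 'I_n) p m :
  edge_ideal k G p -> m \in msupp p -> (2 <= mdeg m)%N.
Proof.
move=> [s [gs ->]]; rewrite big_seq; elim/big_rec: _ m => [|t x ts IH] m.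
  by rewrite msupp0.
move/msuppD_le; rewrite mem_cat => /orP[|/IH//].
move/msupp_mul => [m1 [m2 [_ + ->]]]; have [a [b [_ ->]]] := gs t ts.
by rewrite -mpolyXD msuppX inE => /eqP ->; rewrite !mdegD !mdeg1 leq_addl.
Qed.

(** Only the terms x_a x_b with f S a <> f S b survive, and these are edges. *)
Lemma potential_cycle_edge_ideal (k : fieldType) (n : nat)
    (G : simple_graph 'I_n) (f : {set 'I_n} -> 'I_n -> k) T :
  (forall (S : {set 'I_n}) a b, a \in S -> b \in S -> ~~ adj G a b ->
     f S a = f S b) ->
  edge_ideal k G (potential_cycle f T 0 0).
Proof.
move=> f_const; rewrite potential_cycleE.
apply: ideal_gen_sum => a T'a; apply: ideal_gen_sum => b /andP[T'b lt_ba].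
set S := a |: (b |: T).
have [adj_ab|nadj] := boolP (adj G a b).
  by rewrite [X in ideal_gen _ X]mulrA; apply: ideal_gen_mull; exists a, b.
rewrite (f_const S a b) ?subrr ?mul0r ?mulr0 /S ?inE ?eqxx ?orbT //.
by exists [::]; rewrite big_nil.
Qed.

(** * Components of the complement of an induced subgraph *)

Section Coconnected.

Variables (V : finType) (G : simple_graph V).
Implicit Types (S A : {set V}) (x y v : V).

Lemma adjC x y : adj G x y = adj G y x.
Proof. by rewrite /adj setUC. Qed.

Lemma adjxx x : adj G x x = false.
Proof. by apply/negP => /edges_card2; rewrite setUid cards1. Qed.

Definition nonadj S : rel V :=
  [rel x y | [&& x \in S, y \in S & ~~ adj G x y]].

Lemma nonadj_sym S : connect_sym (nonadj S).
Proof.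
apply: sym_connect_sym => x y; rewrite /nonadj /= adjC.
by case: (x \in S); case: (y \in S).
Qed.

Lemma nonadj_closed S A :
  (forall x y, x \in A -> nonadj S x y -> y \in A) ->
  forall x y, connect (nonadj S) x y -> (x \in A) = (y \in A).
Proof.
move=> stepA; apply: closed_connect; apply: (intro_closed (@nonadj_sym S)).
by move=> x y xy /stepA/(_ xy).
Qed.

(** One representative for each component of the complement of the subgraph
induced on S. *)
Definition coroots S : {set V} := [set r in S | roots (nonadj S) r].

Lemma root_coroots S v : v \in S -> fingraph.root (nonadj S) v \in coroots S.
Proof.
move=> Sv; rewrite inE roots_root ?andbT; last exact: nonadj_sym.
have := connect_root (nonadj S) v; move/(nonadj_closed (A := S)) => <- //.
by move=> x y _ /and3P[].
Qed.

(** The vertices that are components of their own in the complement of the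
subgraph induced on S. *)
Definition universal S : {set V} :=
  [set v in S | [forall u in S, (u != v) ==> adj G v u]].

Lemma universalP S v : reflect
  (v \in S /\ forall u, u \in S -> u != v -> adj G v u) (v \in universal S).
Proof.
rewrite inE; apply: (iffP andP) => -[Sv Av]; split=> //.
  by move=> u Su ne; move/forall_inP/(_ u Su)/implyP: Av; apply.
by apply/forall_inP => u Su; apply/implyP; exact: Av.
Qed.

Lemma universal_connect S v y : v \in universal S ->
  connect (nonadj S) v y -> y = v.
Proof.
case/universalP => Sv adj_v /(nonadj_closed (A := [set v])).
rewrite !inE eqxx => e; apply/eqP; rewrite -e // => x z; rewrite !inE.
move=> /eqP -> /= /and3P[_ Sz]; apply: contraNT; exact: adj_v.
Qed.

Lemma universal_sub_coroots S : universal S \subset coroots S.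
Proof.
apply/subsetP => v uv; rewrite inE; case/universalP: (uv) => -> _ /=.
by rewrite /roots (universal_connect uv (connect_root _ v)).
Qed.

(** * Complete graphs *)

Lemma universal_complete S m : #|S| = m -> universal S = S ->
  induced_iso G (complete_graph m) S.
Proof.
move=> Sm uS; apply/existsP.
pose g := [ffun x : 'I_m => enum_val (cast_ord (esym Sm) x)].
have g_inj : injective g.
  by move=> x y; rewrite !ffunE => /enum_val_inj/cast_ord_inj.
exists g; apply/and3P; split; first exact/injectiveP.
  rewrite eqEcard card_imset // cardsT card_ord Sm leqnn andbT.
  by apply/subsetP => _ /imsetP[x _ ->]; rewrite ffunE enum_valP.
apply/forallP => x; apply/forallP => y.
have gS z : g z \in S by rewrite ffunE enum_valP.
rewrite [adj (complete_graph m) x y]inE cards2.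
have [<-|ne_xy] := eqVneq x y; first by rewrite adjxx.
have := gS x; rewrite -uS => /universalP[_ ->] //.
by rewrite (inj_eq g_inj) eq_sym.
Qed.

(** * Complete bipartite graphs *)

Lemma bipartite_part a b S : induced_iso G (complete_bipartite a b) S ->
  exists A, [/\ A \subset S, #|A| = a, #|S :\: A| = b &
    {in S &, forall x y, adj G x y = (x \in A) (+) (y \in A)}].
Proof.
move=> /existsP[g /and3P[/injectiveP g_inj /eqP gS /forallP g_adj]].
have adj_g s t : adj G (g s) (g t) = adj (complete_bipartite a b) s t.
  by move/forallP/(_ t)/eqP: (g_adj s).
pose A := [set g (inl x) | x : 'I_a].
pose B := [set g (inr y) | y : 'I_b].
have AE (s : 'I_a + 'I_b) : (g s \in A) = if s is inl _ then true else false.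
  apply/imsetP/idP => [[x _ /g_inj ->]//|]; case: s => // x _.
  by exists x.
have sAS : A \subset S.
  by apply/subsetP => _ /imsetP[x _ ->]; rewrite -gS imset_f.
have SB : S :\: A = B.
  apply/setP => v; rewrite in_setD; apply/andP/imsetP => [[A'v]|[y _ ->]].
    rewrite -gS => /imsetP[[x|y] _ v_def]; last by exists y.
    by rewrite v_def AE in A'v.
  by rewrite AE -gS imset_f.
exists A; split=> //.
- by rewrite card_imset ?card_ord // => x y /g_inj[].
- by rewrite SB card_imset ?card_ord // => x y /g_inj[].
move=> v w; rewrite -gS => /imsetP[s _ ->] /imsetP[t _ ->].
rewrite adj_g !AE /adj /= /bipartite_edges.
apply/imset2P/idP => [[x y _ _ /setP e]|].
  have := e s; have := e t; have := e (inl x); have := e (inr y).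
  by rewrite !inE !eqxx /=; case: s e => s _; case: t => t.
case: s => s; case: t => t //= _; first by exists s t.
by exists t s; rewrite // setUC.
Qed.

Lemma bipartite_card a b S :
  induced_iso G (complete_bipartite a b) S -> #|S| = (a + b)%N.
Proof.
move=> /bipartite_part[A [sAS <- <- _]].
by rewrite -(cardsID A S) (setIidPr sAS).
Qed.

Lemma bipartite_nonneighbours a b S v :
  induced_iso G (complete_bipartite a b) S -> v \in S ->
  #|[set u in S | ~~ adj G v u]| = a \/ #|[set u in S | ~~ adj G v u]| = b.
Proof.
move=> /bipartite_part[A [sAS cA cB adjE]] Sv.
have [Av|A'v] := boolP (v \in A); [left; rewrite -cA|right; rewrite -cB].
  congr #|pred_of_set _|; apply/setP => u; rewrite inE.
  have [Su|S'u] := boolP (u \in S); first by rewrite adjE // Av /= negbK.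
  by rewrite (negbTE (contra (subsetP sAS u) S'u)).
congr #|pred_of_set _|; apply/setP => u; rewrite !inE andbC.
by case: (boolP (u \in S)) => Su; rewrite ?andbF ?andbT // adjE // (negbTE A'v).
Qed.

(** The vertices of S not adjacent to a given v in S, including v itself, form
one side of the bipartition; so the pairs {a, b} and {c, d} have a common
element, and their sums agree. *)
Lemma bipartite_sides_uniq a b c d S : (0 < a <= b)%N -> (c <= d)%N ->
  induced_iso G (complete_bipartite a b) S ->
  induced_iso G (complete_bipartite c d) S -> a = c.
Proof.
move=> /andP[a_gt0 le_ab] le_cd isoab isocd.
have := bipartite_card isoab; rewrite (bipartite_card isocd) => cd.
have /card_gt0P[v Sv] : (0 < #|S|)%N.
  by rewrite (bipartite_card isoab) addn_gt0 a_gt0.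
have := bipartite_nonneighbours isoab Sv.
have := bipartite_nonneighbours isocd Sv.
by lia.
Qed.

Lemma bipartite_coroots a b S : (1 < a)%N -> (1 < b)%N ->
  induced_iso G (complete_bipartite a b) S ->
  universal S = set0 /\ (1 < #|coroots S|)%N.
Proof.
move=> a_gt1 b_gt1 /bipartite_part[A [sAS cA cB adjE]]; split.
  apply/setP => v; rewrite in_set0; apply/negP => /universalP[Sv adj_v].
  have [Av|A'v] := boolP (v \in A).
    have /card_gt0P[u] : (0 < #|A :\ v|)%N.
      by move: a_gt1; rewrite -cA (cardsD1 v) Av.
    rewrite !inE => /andP[ne_uv Au]; have Su := subsetP sAS u Au.
    by have := adj_v u Su ne_uv; rewrite adjE // Av Au.
  have /card_gt0P[u] : (0 < #|(S :\: A) :\ v|)%N.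
    by move: b_gt1; rewrite -cB (cardsD1 v) !inE A'v Sv.
  rewrite !inE => /and3P[ne_uv A'u Su].
  by have := adj_v u Su ne_uv; rewrite adjE // (negbTE A'v) (negbTE A'u).
have /card_gt0P[x Ax] : (0 < #|A|)%N by rewrite cA ltnW.
have /card_gt0P[y] : (0 < #|S :\: A|)%N by rewrite cB ltnW.
rewrite inE => /andP[A'y Sy]; have Sx := subsetP sAS x Ax.
apply/card_gt1P; exists (fingraph.root (nonadj S) x).
exists (fingraph.root (nonadj S) y).
rewrite !root_coroots //; split=> //.
rewrite root_connect; last exact: nonadj_sym.
apply: contraNN A'y => /(nonadj_closed (A := A)) <- // u v Au /= /and3P[Su Sv].
by rewrite adjE // Au /= negbK.
Qed.

(** The contribution of a single vertex set to the inequality.  If G_S is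
complete bipartite with sides of size at least 2, its complement has two
components and no isolated vertex.  Otherwise compare isolated vertices with
components: either every vertex is isolated and S is a clique, or the component
of some vertex w is not an isolated vertex and makes up for the - 1. *)
Lemma coroots_bound S i : #|S| = (i + 2)%N ->
  (#|universal S| + \sum_(2 <= a < ((i + 2) %/ 2).+1)
      induced_iso G (complete_bipartite a (i + 2 - a)) S
   <= #|coroots S|.-1 + induced_iso G (complete_graph (i + 2)) S)%N.
Proof.
move=> cS; set bip := (\sum_(_ <= a < _) _)%N.
have bip_range a : (2 <= a < ((i + 2) %/ 2).+1)%N ->
    [/\ 0 < a <= i + 2 - a, 1 < a & 1 < i + 2 - a]%N.
  by move=> ?; split; lia.
have [bip0|] := posnP bip; last first.
  rewrite lt0n sum_nat_seq_neq0 => /hasP[a]; rewrite mem_index_iota => a_in.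
  rewrite /= eqb0 negbK => iso_a; have [le_ab a_gt1 b_gt1] := bip_range a a_in.
  have [-> coroots_gt1] := bipartite_coroots a_gt1 b_gt1 iso_a.
  rewrite cards0 add0n /bip (bigD1_seq a) ?mem_index_iota ?iota_uniq //=.
  rewrite iso_a big_seq_cond big1 => [|c]; first by lia.
  rewrite mem_index_iota => /andP[/bip_range[/andP[_ le_cd] _ _] ne_ca].
  apply/eqP; rewrite eqb0; apply: contraNN ne_ca => iso_c.
  by rewrite (bipartite_sides_uniq le_ab le_cd iso_a iso_c).
rewrite bip0 addn0; have [uS|nuS] := eqVneq (universal S) S.
  rewrite (universal_complete cS uS) uS.
  by have := subset_leq_card (universal_sub_coroots S); rewrite uS; lia.
have /subsetPn[w Sw nuw] : ~~ (S \subset universal S).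
  apply: contraNN nuS => sub; rewrite eqEsubset sub andbT.
  by apply/subsetP => v /universalP[].
pose r := fingraph.root (nonadj S) w.
have nur : r \notin universal S.
  apply: contra nuw => ur; have -> // : w = r.
  by apply: (universal_connect ur); rewrite nonadj_sym connect_root.
have : universal S \proper coroots S.
  rewrite properE universal_sub_coroots; apply/subsetPn.
  by exists r; rewrite // root_coroots.
by move/proper_card; lia.
Qed.

(** * Counting *)

Definition neighbours v : {set V} := [set u | adj G v u].

Lemma degreeE v : degree G v = #|neighbours v|.
Proof.
rewrite /degree -(card_in_imset (f := fun u => [set v; u]) (D := neighbours v)).
  congr #|pred_of_set _|; apply/setP => A; rewrite inE.
  apply/andP/imsetP => [[EA Av]|[u]].
    have /eqP := edges_card2 EA; rewrite (cardsD1 v) Av add1n eqSS.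
    move=> /cards1P[u uE]; have Auv : A = [set v; u] by rewrite -uE setD1K.
    by exists u; rewrite // inE /adj -Auv.
  by rewrite inE => adj_vu ->; rewrite !inE eqxx.
move=> x y; rewrite !inE => vx vy /setP/(_ x); rewrite !inE eqxx orbT.
case: eqP => [e|_] /esym; last by move/eqP.
by rewrite e adjxx in vx.
Qed.

(** Double counting of the pairs (v, S) with v universal in S: such a set S is v
together with m of its neighbours. *)
Lemma sum_bin_degree m :
  (\sum_v 'C(degree G v, m) =
   \sum_(S : {set V} | #|S| == m.+1) #|universal S|)%N.
Proof.
have binE v : 'C(degree G v, m) =
    (\sum_(S : {set V} | #|S| == m.+1) (v \in universal S))%N.
  rewrite degreeE -cards_draws -big_mkcondr sum1_card.
  rewrite -(card_in_imset (f := fun A => v |: A)); last first.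
    have nv (A : {set V}) : A \in [set A : {set V} | A \subset neighbours v &
        #|A| == m] -> v \notin A.
      rewrite inE => /andP[/subsetP sA _].
      by apply/negP => /sA; rewrite inE adjxx.
    by move=> A B /nv A'v /nv B'v /(congr1 (fun X => X :\ v)); rewrite !setU1K.
  apply: eq_card => S; rewrite [RHS]inE; apply/imsetP/andP.
    move=> [A]; rewrite inE => /andP[/subsetP sA /eqP cA] ->.
    have A'v : v \notin A by apply/negP => /sA; rewrite inE adjxx.
    rewrite cardsU1 A'v cA; split=> //; apply/universalP.
    rewrite setU11; split=> // u.
    rewrite !inE => /orP[/eqP ->|/sA]; first by rewrite eqxx.
    by rewrite inE.
  move=> [/eqP cS /universalP[Sv adj_v]].
  exists (S :\ v); last by rewrite setD1K.
  rewrite inE; apply/andP; split; last first.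
    by move: cS; rewrite (cardsD1 v) Sv => -[<-].
  by apply/subsetP => u; rewrite !inE => /andP[ne Su]; exact: adj_v.
under eq_bigr => v _ do rewrite binE.
rewrite exchange_big; apply: eq_bigr => S _.
by rewrite -big_mkcond sum1_card.
Qed.

Lemma num_induced_sum (W : finType) (H : simple_graph W) m :
  (forall S, induced_iso G H S -> #|S| = m) ->
  num_induced G H = (\sum_(S : {set V} | #|S| == m) induced_iso G H S)%N.
Proof.
move=> cS; rewrite -big_mkcondr sum1_card.
apply: eq_card => S; rewrite !inE [RHS]unfold_in /=.
by case: (boolP (induced_iso G H S)) => [/cS ->|]; rewrite ?eqxx ?andbF.
Qed.

Lemma complete_card m S : induced_iso G (complete_graph m) S -> #|S| = m.
Proof.
case/existsP => g /and3P[/injectiveP g_inj /eqP <- _].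
by rewrite card_imset // cardsT card_ord.
Qed.

Lemma degree_count_bound i :
  (\sum_v 'C(degree G v, i.+1)
     + \sum_(2 <= a < ((i + 2) %/ 2).+1) num_bipartite G a (i + 2 - a)
   <= \sum_(S : {set V} | #|S| == (i + 2)%N) #|coroots S|.-1
     + num_complete G (i + 2))%N.
Proof.
rewrite sum_bin_degree -addn2 /num_complete (@num_induced_sum _ _ (i + 2));
  last exact: complete_card.
have -> : (\sum_(2 <= a < ((i + 2) %/ 2).+1) num_bipartite G a (i + 2 - a) =
   \sum_(2 <= a < ((i + 2) %/ 2).+1) \sum_(S : {set V} | #|S| == (i + 2)%N)
      induced_iso G (complete_bipartite a (i + 2 - a)) S)%N.
  rewrite !big_nat; apply: eq_bigr => a a_range; apply: num_induced_sum => S.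
  by move/bipartite_card => ->; lia.
rewrite exchange_big -!big_split; apply: leq_sum => S /eqP.
exact: coroots_bound.
Qed.

End Coconnected.

(** * The lower bound *)

(** For each S, the indicator functions of all but one of the components of the
complement of G_S are independent modulo constants, which amounts to the
independence of their Koszul cycles. *)
Lemma graded_betti_coroots (k : fieldType) (n : nat) (G : simple_graph 'I_n)
    (F : graded_free_resolution (edge_ideal k G)) (i : nat) :
  (\sum_(S : {set 'I_n} | #|S| == (i + 2)%N) #|coroots G S|.-1
   <= graded_betti F i (i + 2))%N.
Proof.
pose J := [set p : {set 'I_n} * 'I_n | [&& #|p.1| == (i + 2)%N,
  p.2 \in coroots G p.1 & Some p.2 != [pick r in coroots G p.1]]].
have <- : #|J| =
    (\sum_(S : {set 'I_n} | #|S| == (i + 2)%N) #|coroots G S|.-1)%N.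
  rewrite -sum1_card (eq_bigl (fun p : {set 'I_n} * 'I_n =>
    (#|p.1| == (i + 2)%N) && ((p.2 \in coroots G p.1) &&
    (Some p.2 != [pick r in coroots G p.1])))); last by move=> p; rewrite inE.
  rewrite -(pair_big_dep (fun S : {set 'I_n} => #|S| == (i + 2)%N)
    (fun S r => (r \in coroots G S) && (Some r != [pick r in coroots G S]))
    (fun _ _ => 1%N)) /=.
  apply: eq_bigr => S _; rewrite sum1_card; case: pickP => [r0 r0_in|no_r].
    rewrite [X in _ = X.-1](cardsD1 r0) r0_in add1n /=; apply: eq_card => r.
    by rewrite in_setD1 [LHS]unfold_in andbC.
  rewrite [X in _ = X.-1]eq_card0 // eq_card0 // => r.
  by apply: negbTE; rewrite negb_and no_r.
(* The indicator function, on S only, of the component represented by r. *)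
pose f (j : 'I_#|J|) (S : {set 'I_n}) a : k :=
  ((S == (enum_val j).1) &&
   (fingraph.root (nonadj G S) a == (enum_val j).2))%:R.
have J_def (j : 'I_#|J|) := enum_valP j.
apply: (@graded_betti_ge _ _ _ F _ (fun j => potential_cycle (f j))).
- by move=> p m; exact: edge_ideal_mdeg.
- by move=> j T; exact: koszulK.
- move=> j T; apply: potential_cycle_edge_ideal => S a b Sa Sb nadj_ab.
  have connect_ab : connect (nonadj G S) a b.
    by apply: connect1; rewrite /nonadj /= Sa Sb.
  by rewrite /f (fingraph.rootP (@nonadj_sym _ G S) connect_ab).
- move=> j T; apply: potential_cycle_supp => S a nS; rewrite /f.
  case: eqP => // S_def; move: (J_def j); rewrite inE -S_def.
  by rewrite (negbTE nS).
- by move=> j T; exact: graded_potential_cycle.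
move=> c c0 j; have := J_def j; case j_def: (enum_val j) => [S r].
rewrite inE /= => /and3P[_ r_in].
case pickE: [pick x in coroots G S] => [r0|]; last first.
  by case: pickP pickE => // /(_ r); rewrite r_in.
have r0_in : r0 \in coroots G S by case: pickP pickE => // r1 r1_in [<-].
rewrite (inj_eq Some_inj) => ne_r.
have {}c0 T : potential_cycle (fun S a => \sum_l c l * f l S a) T = 0.
  by rewrite -potential_cycle_sum.
move: (r_in) (r0_in); rewrite ![_ \in coroots _ _]inE.
move=> /andP[Sr /eqP root_r] /andP[Sr0 /eqP root_r0].
(* On S the combination takes the value c j at r, and 0 at the omitted
   representative r0. *)
have := potential_cycle_eq0 c0 Sr Sr0; rewrite /f root_r root_r0.
rewrite (bigD1 j) //= j_def /= !eqxx mulr1 big1 ?addr0 => [->|l ne_lj].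
  rewrite big1 // => l _.
  case: andP => [[/eqP eS /eqP er]|_]; last by rewrite mulr0.
  have := J_def l; rewrite inE -eS -er => /and3P[_ _].
  by rewrite /= pickE eqxx.
case: andP => [[/eqP eS /eqP er]|_]; last by rewrite mulr0.
case/eqP: ne_lj; apply: enum_val_inj; rewrite j_def eS er.
by case: (enum_val l).
Qed.

Theorem proposition3p1 (k : fieldType) (n : nat) (G : simple_graph 'I_n)
    (F : graded_free_resolution (edge_ideal k G)) (i : nat) :
  (\sum_(v : 'I_n) 'C(degree G v, i.+1))%N%:Z
    - (num_complete G (i + 2))%:Z
    + (\sum_(2 <= a < ((i + 2) %/ 2).+1) num_bipartite G a (i + 2 - a))%N%:Z
  <= (graded_betti F i (i + 2))%:Z.
Proof.
rewrite addrAC lerBlDr -!PoszD lez_nat.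
apply: leq_trans (degree_count_bound G i) _.
by rewrite leq_add2r graded_betti_coroots.
Qed.
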